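(* Let $\Phi:\mathbf{N}\to[1,\infty)$ be any nondecreasing function satisfying $\lim_{n\to\infty}\Phi(n)=+\infty$. Then $$\sup_{\|f\|_{H_1}\le 1}\ \sum_{n=1}^{\infty}\frac{\|S_{n,n}f\|_1\,\Phi(n)}{n\log^2(n+1)}=\infty,$$ where the supremum is taken over all $f\in H_1(G^2)$ with $\|f\|_{H_1}\le 1$, $S_{n,n}f$ is the $n$-th quadratic partial sum of the two-dimensional Walsh-Fourier series of $f$, and $\|\cdot\|_1$ is the norm of $L_1(G^2)$.
   Context: $\mathbf{N}_+$ denotes the set of positive integers and $\mathbf{N}=\mathbf{N}_+\cup\{0\}$. Walsh group: $Z_2=\{0,1\}$ is the discrete cyclic group of order 2 (addition modulo 2) with Haar measure giving each singleton measure $1/2$. $G$ is the complete direct product of countably infinitely many copies of $Z_2$; its elements are sequences $x=(x_0,x_1,\dots,x_k,\dots)$ with $x_k\in\{0,1\}$, with coordinate-wise addition, the product topology and the product measure $\mu$ (so $\mu(G)=1$). On $G^2=G\times G$ the product measure is also denoted by $\mu$, and $L_p(G^2)$ is the Lebesgue space with norm $\|\cdot\|_p$. Dyadic intervals: $I_0(x)=G$ and, for $n\in\mathbf{N}_+$, $I_n(x)=\{y\in G: y_0=x_0,\dots,y_{n-1}=x_{n-1}\}$. Walsh-Paley functions: every $n\in\mathbf{N}$ is written in base 2 as $n=\sum_{i=0}^\infty n_i2^i$ with $n_i\in\{0,1\}$. The Rademacher functions are $r_k(x)=(-1)^{x_k}$ for $x\in G$, $k\in\mathbf{N}$, and the Walsh-Paley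 functions are $w_n(x)=\prod_{k=0}^\infty (r_k(x))^{n_k}$ (so $w_0=1$). Fourier coefficients and partial sums: for $f\in L_1(G^2)$, $\widehat f(i,j)=\int_{G^2}f(x,y)w_i(x)w_j(y)\,d\mu(x,y)$, and the rectangular partial sums are $$S_{M,N}f(x,y)=\sum_{i=0}^{M-1}\sum_{j=0}^{N-1}\widehat f(i,j)w_i(x)w_j(y).$$ Dyadic Hardy space: for $f\in L_1(G^2)$ the dyadic maximal function is $$f^*(x,y)=\sup_{n\in\mathbf{N}}\frac{1}{\mu(I_n(x)\times I_n(y))}\left|\int_{I_n(x)\times I_n(y)}f(s,t)\,d\mu(s,t)\right|.$$ $H_1(G^2)$ consists of all functions $f\in L_1(G^2)$ with $\|f\|_{H_1}:=\|f^*\|_1<\infty$. *)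

(* Defs.v *)
From HB Require Import structures.
From mathcomp Require Import all_boot all_order all_algebra.
From mathcomp Require Import interval_inference.
From mathcomp Require Import all_classical all_reals all_analysis.
From mathcomp Require Import measurable_realfun.
From mathcomp Require Import zify ring lra.

Set Implicit Arguments.
Unset Strict Implicit.
Unset Printing Implicit Defensive.

Import Order.TTheory GRing.Theory Num.Theory.
Import numFieldNormedType.Exports.

Local Open Scope classical_set_scope.
Local Open Scope ring_scope.

(* [bool], with [xorb] as addition, plays the role of the cyclic group of
   order 2; the Walsh group carries the product sigma-algebra. *)
Definition coordinate_sets : set (set (nat -> bool)) :=
  [set A | exists k (B : set bool), A = (fun x => x k) @^-1` B].

Definition walsh_group : Type := g_sigma_algebraType coordinate_sets.
HB.instance Definition _ := Measurable.on walsh_group.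

(* Mass 1/2 on each singleton: see [haarZ2_set1]. *)
Definition haarZ2 (R : realType) : probability bool R := bernoulli_prob 2^-1.

Definition rectangle (n : nat) (B : nat -> set bool) : set walsh_group :=
  [set x | forall k, (k < n)%N -> B k (x k)].

Definition is_product_measure (R : realType)
    (mu : set walsh_group -> \bar R) : Prop :=
  forall n B, mu (rectangle n B) = (\prod_(k < n) haarZ2 R (B k))%E.

Lemma haarZ2_set1 (R : realType) (b : bool) :
  haarZ2 R [set b] = (2^-1 : R)%:E.
Proof.
have h : 0 <= (2^-1 : R) <= 1 by lra.
transitivity ((2^-1 : R)%:E * \d_true [set b]
            + (1 - 2^-1 : R)%:E * \d_false [set b])%E.
  exact: bernoulli_probE h _.
have -> : (1 - 2^-1 : R) = 2^-1 by lra.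
rewrite !diracE !classical_sets.in_set1; case: b => /=.
all: by rewrite ?eqxx /= ?mule0 ?mule1 ?adde0 ?add0e.
Qed.

Lemma measurable_rectangle n B : measurable (rectangle n B).
Proof.
have -> : rectangle n B =
  \bigcap_(k in `I_n) ((fun x : walsh_group => x k) @^-1` B k).
  by apply/seteqP; split => x.
apply: bigcap_measurableType => k _.
by apply: sub_sigma_algebra; exists k, (B k).
Qed.

(* The product measure exists: it is the law of the sequence of binary digits of
   a uniform variable on [0, 1[. *)
Section existence.
Context {R : realType}.

Let dbl (x : R) : R := if x < 2^-1 then 2 * x else 2 * x - 1.
Let bit (x : R) : bool := 2^-1 <= x.
Let digits (x : R) : walsh_group := fun k => bit (iter k dbl x).

Let measurable_dbl : measurable_fun setT dbl.
Proof.
apply: measurable_fun_if => //=.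
- exact: measurable_fun_ltr.
- apply: measurable_funTS; apply: measurable_funB => //.
Qed.

Let measurable_iter k : measurable_fun setT (iter k dbl).
Proof.
by elim: k => [|k ih] /=; [exact: measurable_id|exact: measurableT_comp].
Qed.

Let measurable_bit : measurable_fun setT bit.
Proof. exact: measurable_fun_ler. Qed.

Let measurable_digits : measurable_fun setT digits.
Proof.
apply: (@measurability _ _ _ _ _ digits coordinate_sets) => //.
move=> _ [_ [k [B ->]] <-].
have -> : digits @^-1` ((fun x => x k) @^-1` B) = (bit \o iter k dbl) @^-1` B
  by [].
by apply: (measurableT_comp measurable_bit (measurable_iter k)).
Qed.

Let I01 : set R := `[0, 1[%classic.
Let mI01 : measurable I01. Proof. exact: measurable_itv. Qed.

Let unif : set (measurableTypeR R) -> \bar R := mrestr lebesgue_measure mI01.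

HB.instance Definition _ := Measure.on unif.

Let unifT : unif setT = 1%E.
Proof.
rewrite /unif /mrestr setTI.
by rewrite lebesgue_measure_itv/= lte_fin ltr01 oppr0 adde0.
Qed.

HB.instance Definition _ := Measure_isProbability.Build _ _ _ unif unifT.
Let mdigits : {mfun (measurableTypeR R) >-> walsh_group} :=
  HB.pack digits
    (isMeasurableFun.Build _ _ (measurableTypeR R) walsh_group digits
       measurable_digits).

Let uniform_bits : probability walsh_group R := distribution unif mdigits.

Let lend (n : nat) : (nat -> bool) -> R :=
  nat_rect (fun _ => (nat -> bool) -> R) (fun _ => 0)
    (fun _ l b => ((b 0%N)%:R + l (fun k => b k.+1)) / 2) n.

Let lend_bnd n b : 0 <= lend n b /\ lend n b + 2^-1 ^+ n <= 1.
Proof.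
elim: n b => [|n ih] b /=; first by rewrite expr0; split; lra.
have [h1 h2] := ih (fun k => b k.+1); rewrite exprS.
by case: (b 0%N) => /=; split; lra.
Qed.

Let digits_itv n (b : nat -> bool) (x : R) : 0 <= x < 1 ->
  (forall k, (k < n)%N -> digits x k = b k) <->
  lend n b <= x < lend n b + 2^-1 ^+ n.
Proof.
elim: n b x => [|n ih] b x x01 /=; first by rewrite expr0 add0r; split.
have [l0 l1] := lend_bnd n (fun k => b k.+1).
have dbl01 : 0 <= dbl x < 1 by rewrite /dbl; case: ltP => h; lra.
have E : (forall k, (k < n.+1)%N -> digits x k = b k) <->
    bit x = b 0%N /\ (forall k, (k < n)%N -> digits (dbl x) k = b k.+1).
  split=> [h|[h0 h] [|k] kn].
  - split=> [|k kn]; first exact: (h 0%N).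
    by have := h k.+1 kn; rewrite /digits iterSr.
  - exact: h0.
  - by rewrite /digits iterSr; exact: h.
rewrite E ih // exprS /bit /dbl.
case: (b 0%N) => /=; case: ltP => h; split.
all: try by move=> [? ?]; lra.
all: try by move=> ?; exfalso; lra.
all: by move=> ?; split => //; lra.
Qed.

Let uniform_bits_cylinder n (b : nat -> bool) :
  uniform_bits (rectangle n (fun k => [set b k])) = (2^-1 ^+ n)%:E.
Proof.
have [l0 l1] := lend_bnd n b.
rewrite /uniform_bits /= /distribution /pushforward /unif /mrestr.
have -> : digits @^-1` rectangle n (fun k => [set b k]) `&` I01
    = `[lend n b, lend n b + 2^-1 ^+ n[%classic.
  apply/seteqP; split=> x /=.
    by rewrite /I01 /= !in_itv /= => -[h x01]; apply/digits_itv.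
  rewrite /I01 /= !in_itv /= => h.
  have x01 : 0 <= x < 1 by lra.
  by split=> //; apply/digits_itv.
rewrite lebesgue_measure_itv/= lte_fin ltrDl exprn_gt0//.
by rewrite -EFinB addrC addKr.
Qed.

Let upd (B : nat -> set bool) i C : nat -> set bool :=
  fun k => if k == i then C else B k.

Let uniform_bits_part i n (B : nat -> set bool) : (i <= n)%N ->
  (forall k, (i <= k < n)%N -> exists b, B k = [set b]) ->
  uniform_bits (rectangle n B) = (\prod_(k < n) haarZ2 R (B k))%E.
Proof.
elim: i B => [|i ih] B lein hB.
  have [b hb] : exists b : nat -> bool, forall k, (k < n)%N -> B k = [set b k].
    have /choice[b hb] : forall k, exists b, (k < n)%N -> B k = [set b].
      move=> k; have [kn|kn] := boolP (k < n)%N; last by exists true.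
      by have [b bE] := hB k kn; exists b.
    by exists b.
  have -> : rectangle n B = rectangle n (fun k => [set b k]).
    by apply/seteqP; split=> x h k kn; have := h k kn; rewrite hb.
  rewrite uniform_bits_cylinder.
  under eq_bigr => k _ do rewrite hb // haarZ2_set1.
  by rewrite prodEFin prodr_const card_ord.
pose oi := Ordinal lein.
have prodU C : (\prod_(k < n) haarZ2 R (upd B i C k) =
    haarZ2 R C * \prod_(k < n | k != oi) haarZ2 R (B k))%E.
  rewrite (bigD1 oi) //= /upd eqxx; congr (_ * _)%E.
  by apply: eq_bigr => k; rewrite -val_eqE /= => /negbTE ->.
have main C : (exists b, C = [set b]) \/ C = set0 ->
    uniform_bits (rectangle n (upd B i C)) =
    (\prod_(k < n) haarZ2 R (upd B i C k))%E.
  case=> [[b Cb]|C0].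
    apply: ih; first exact: ltnW.
    move=> k /andP[ik kn]; rewrite /upd; case: eqP => [_|ki]; first by exists b.
    by apply: hB; lia.
  rewrite prodU C0 measure0 mul0e (_ : rectangle _ _ = set0) ?measure0//.
  by apply/seteqP; split=> // x /(_ i lein); rewrite /upd eqxx.
have sub1 (b : bool) : (exists c, B i `&` [set b] = [set c]) \/ B i `&` [set b] = set0.
  have [hb|hb] := pselect (B i b); [left; exists b|right]; apply/seteqP; split.
  - by move=> c [].
  - by move=> c ->.
  - by move=> c [? cb]; apply: hb; rewrite -cb.
  - by [].
have BE : B i = (B i `&` [set true]) `|` (B i `&` [set false]).
  rewrite -setIUr; apply/seteqP; split=> [c Bc|c []//]; split => //.
  by case: c {Bc}; [left|right].
have disj : (B i `&` [set true]) `&` (B i `&` [set false]) = set0.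
  by apply/seteqP; split=> // c [[_ ->] [_ //]].
have -> : rectangle n B = rectangle n (upd B i (B i `&` [set true]))
    `|` rectangle n (upd B i (B i `&` [set false])).
  apply/seteqP; split=> [x h|x].
    have hi := h i lein.
    have [xi|xi] : x i = true \/ x i = false by case: (x i); [left|right].
      by left=> k kn; rewrite /upd; case: eqP => [->|_]; [rewrite -xi|exact: h].
    by right=> k kn; rewrite /upd; case: eqP => [->|_]; [rewrite -xi|exact: h].
  by case=> h k kn; have := h k kn; rewrite /upd; case: eqP => [->[]|].
transitivity (uniform_bits (rectangle n (upd B i (B i `&` [set true]))) +
    uniform_bits (rectangle n (upd B i (B i `&` [set false]))))%E.
  apply: measureU; try exact: measurable_rectangle.
  apply/seteqP; split=> // x [/(_ i lein) + /(_ i lein)].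
  by rewrite /upd eqxx => -[_ ->] [_ //].
rewrite !main // !prodU -ge0_muleDl//.
rewrite [RHS](bigD1 oi) //=; congr (_ * _)%E.
by rewrite [in RHS]BE measureU.
Qed.

Lemma product_measure_exists :
  exists mu : probability walsh_group R, is_product_measure mu.
Proof.
exists uniform_bits => n B; apply: (@uniform_bits_part n) => // k.
by case/andP => /leq_ltn_trans h /h; rewrite ltnn.
Qed.

End existence.

Lemma product_measure_unique (R : realType)
    (mu nu : probability walsh_group R) :
  is_product_measure mu -> is_product_measure nu ->
  forall A, measurable A -> mu A = nu A.
Proof.
move=> hmu hnu A mA.
pose C := [set A | exists n B, A = rectangle n B].
apply: (measure_unique C (fun=> setT)) => //.
- rewrite /measurable/=; apply/seteqP; split.
    apply: smallest_sub; first exact: smallest_sigma_algebra.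
    move=> _ [k [B ->]]; apply: sub_sigma_algebra.
    exists k.+1, (fun j => if j == k then B else setT).
    apply/seteqP; split=> [x /= h j _|x /(_ k (ltnSn k))]; last by rewrite eqxx.
    by case: eqP => [->|].
  apply: smallest_sub; first exact: sigma_algebra_measurable.
  by move=> _ [n [B ->]]; exact: measurable_rectangle.
- move=> _ _ [n [B ->]] [m [D ->]].
  exists (maxn n m), (fun k => (if (k < n)%N then B k else setT) `&`
                               (if (k < m)%N then D k else setT)).
  apply/seteqP; split=> [x [h1 h2] k _|x h].
    by split; case: ifP => // kn; [exact: h1|exact: h2].
  split=> k kn.
    by have [] := h k (leq_trans kn (leq_maxl _ _)); rewrite kn.
  by have [_] := h k (leq_trans kn (leq_maxr _ _)); rewrite kn.
- move=> _; exists 0%N, (fun=> setT).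
  by apply/seteqP; split.
- by rewrite bigcup_const.
- by move=> _ [n [B ->]]; exact: etrans (hmu n B) (esym (hnu n B)).
- by move=> _; apply: (@le_lt_trans _ _ 1%E); rewrite ?probability_le1 ?ltry.
Qed.

(* Characterized by [walsh_measureP], uniquely by [product_measure_unique]. *)
Definition walsh_measure (R : realType) : probability walsh_group R :=
  sval (cid (@product_measure_exists R)).

Lemma walsh_measureP (R : realType) : is_product_measure (walsh_measure R).
Proof. by rewrite /walsh_measure; case: cid. Qed.

Definition walsh_measure2 (R : realType) :
    probability (walsh_group * walsh_group)%type R :=
  (walsh_measure R \x walsh_measure R)%E.

Definition dyadic_interval (n : nat) (x : walsh_group) : set walsh_group :=
  [set y | forall k, (k < n)%N -> y k = x k].

Definition binary_digit (n k : nat) : bool := odd (n %/ 2 ^ k).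

Definition rademacher (R : realType) (k : nat) (x : walsh_group) : R :=
  (-1) ^+ x k.

(* The product over all k reduces to k < n: see [binary_digit_eq0]. *)
Definition walsh (R : realType) (n : nat) (x : walsh_group) : R :=
  \prod_(k < n) rademacher R k x ^+ binary_digit n k.

Lemma binary_digit_eq0 n k : (n <= k)%N -> binary_digit n k = false.
Proof.
move=> nk; rewrite /binary_digit divn_small //.
by rewrite (leq_ltn_trans nk) // ltn_expl.
Qed.

Lemma binary_digit_sum n : (\sum_(k < n) binary_digit n k * 2 ^ k)%N = n.
Proof.
suff H m : (n = \sum_(k < m) binary_digit n k * 2 ^ k + n %/ 2 ^ m * 2 ^ m)%N.
  by have := H n; rewrite (divn_small (ltn_expl n (ltnSn 1))) addn0 => /esym.
elim: m => [|m ih]; first by rewrite big_ord0 expn0 divn1 muln1.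
rewrite {1}ih big_ord_recr /= -addnA; congr addn.
rewrite /binary_digit expnSr divnMA -modn2.
by rewrite {1}(divn_eq (n %/ 2 ^ m) 2) mulnDl addnC mulnA mulnAC.
Qed.

Section fourier.
Context {R : realType}.
Implicit Types f : walsh_group * walsh_group -> R.
Local Notation mu2 := (walsh_measure2 R).

Definition fourier_coef f (i j : nat) : R :=
  \int[mu2]_z (f z * walsh R i z.1 * walsh R j z.2).

Definition partial_sum (M N : nat) f (z : walsh_group * walsh_group) : R :=
  \sum_(i < M) \sum_(j < N) fourier_coef f i j * walsh R i z.1 * walsh R j z.2.

Definition norm1 f : \bar R := 'N[mu2]_1[EFin \o f].

Definition dyadic_square (n : nat) (z : walsh_group * walsh_group) :
    set (walsh_group * walsh_group) :=
  dyadic_interval n z.1 `*` dyadic_interval n z.2.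

Definition dyadic_maximal f (z : walsh_group * walsh_group) : \bar R :=
  ereal_sup [set ((fine (mu2 (dyadic_square n z)))^-1 *
                  `|\int[mu2]_(w in dyadic_square n z) f w|)%:E | n in setT].

Definition hardy_norm f : \bar R := 'N[mu2]_1[dyadic_maximal f].

(* Elements of L_1 are represented by measurable functions, not by classes modulo
   a.e. equality; all the quantities above depend only on the class. *)
Definition hardy_space : set (walsh_group * walsh_group -> R) :=
  [set f : walsh_group * walsh_group -> R | mu2.-integrable setT (EFin \o f) /\ (hardy_norm f < +oo)%E].

End fourier.
Arguments hardy_space R : clear implicits.

(* Main.v *)
Require Import Defs.
From mathcomp Require Import all_boot all_order all_algebra.
From mathcomp Require Import all_classical all_reals all_analysis.
From mathcomp Require Import measurable_realfun zify ring lra.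

Set Implicit Arguments.
Unset Strict Implicit.
Unset Printing Implicit Defensive.

Import Order.TTheory GRing.Theory Num.Theory.
Import numFieldNormedType.Exports.

Local Open Scope classical_set_scope.
Local Open Scope ring_scope.

(** The test functions are the atoms f = a (x) a, where
    a = D_{2^(N+1)} - D_{2^N} = 2^N r_N 1_{I_N(0)} and D_k denotes the Dirichlet
    kernel w_0 + ... + w_{k-1} ([square_atom]).  Averaging f over a dyadic square
    of side at least 2^-N gives 0 and over a smaller one gives a value of f, so
    that f^* = |f| and the Hardy norm of f is the square of the L_1 norm of a,
    namely 1 ([hardy_norm_square_atom]).

    The Fourier coefficients of a of index below 2^(N+1) are 1 on the block
    [2^N, 2^(N+1)) and 0 before it.  Hence, for k in this block,
    S_{k,k} f = P_k (x) P_k with P_k = D_k - D_{2^N}, and the L_1 norm of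
    S_{k,k} f is the square of that of P_k ([norm1_partial_sum_square_atom]).

    On the annulus I_m(0) \ I_{m+1}(0) each complete block of 2^(m+1)
    consecutive Walsh functions sums to zero, so |D_k| is there the distance
    from k to the multiples of 2^(m+1) ([normr_dirichlet]).  Since 2^N is such a
    multiple when m < N, |P_k| has the same value, and integrating over the
    annuli yields ||P_k||_1 >= sum_{m<N} tent_m(k) / 2^(m+1)
    ([le_tent_average]).  The distance tent_m(k) has mean 2^m / 2 over the
    block, so this lower bound has mean N / 4 there, and its square has mean at
    least N^2 / 16 ([sum_sqr_tent_average]).

    On the block the weight Phi(k) / (k log^2 (k+1)) is at least
    Phi(2^N) / (2^(N+1) (N+1)^2), so the block alone contributes at least
    Phi(2^N) / 128 to the series of f if N >= 1 ([norm1_partial_sum_series_ge]).  This is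
    unbounded in N. *)

(** * Distances to multiples of a power of two *)

(** The distance from [k] to the nearest multiple of [2 ^ m.+1]. *)
Definition tent (m k : nat) : nat :=
  minn (k %% 2 ^ m.+1) (2 ^ m.+1 - k %% 2 ^ m.+1).

(** Terms half a period apart add up to [2 ^ m]. *)
Lemma sum_tent_period (m q : nat) :
  (\sum_(q * 2 ^ m.+1 <= k < q.+1 * 2 ^ m.+1) tent m k = 2 ^ m * 2 ^ m)%N.
Proof.
pose M := (2 ^ m)%N; have L2 : (2 ^ m.+1 = M + M)%N by rewrite expnS mul2n addnn.
rewrite mulSnr -{1}[(q * _)%N]add0n big_addn addKn [X in \sum_(_ <= _ < X) _]L2.
have shift F : (\sum_(M <= t < M + M) F t = \sum_(0 <= t < M) F (t + M))%N.
  by rewrite -{1}[M]add0n big_addn addnK.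
rewrite (@big_cat_nat _ _ _ M)/= ?leq_addr// shift.
rewrite -big_split/= (eq_big_nat _ _ (F2 := fun=> M)).
  by rewrite sum_nat_const_nat subn0.
move=> t /andP[_ tM].
have modL s : (s < 2 ^ m.+1)%N -> ((s + q * 2 ^ m.+1) %% 2 ^ m.+1 = s)%N.
  by move=> sL; rewrite addnC modnMDl modn_small.
by rewrite /tent !modL L2; lia.
Qed.

Lemma sum_tent_dyadic (m N : nat) : (m < N)%N ->
  (\sum_(2 ^ N <= k < 2 ^ N.+1) tent m k = 2 ^ (N + m).-1)%N.
Proof.
move=> mN.
have sumq q r : (\sum_(q * 2 ^ m.+1 <= k < (q + r) * 2 ^ m.+1) tent m k
    = r * (2 ^ m * 2 ^ m))%N.
  elim: r => [|r ih]; first by rewrite addn0 mul0n big_geq.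
  rewrite (@big_cat_nat _ _ _ ((q + r) * 2 ^ m.+1)%N)/=; last 2 first.
  - by rewrite leq_mul2r leq_addr orbT.
  - by rewrite leq_mul2r; lia.
  by rewrite ih addnS sum_tent_period mulSn addnC.
have := sumq (2 ^ (N - m.+1))%N (2 ^ (N - m.+1))%N.
rewrite addnn -mul2n -expnS -!expnD.
rewrite !subnK//.
(have -> : ((N - m.+1).+1 + m.+1 = N.+1)%N by lia) => ->.
by congr expn; lia.
Qed.

(** * Walsh functions and Dirichlet kernels near zero *)

Section walsh_system.
Context {R : realType}.
Implicit Types x : walsh_group.
Local Notation walsh := (walsh R).

(** A range of factors not depending on the index, so that two Walsh functions can
    be multiplied factor by factor. *)
Lemma walshE (n K : nat) x : (n <= K)%N ->
  walsh n x = \prod_(k < K) rademacher R k x ^+ binary_digit n k.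
Proof.
move=> nK; rewrite /Defs.walsh.
rewrite (big_ord_widen K (fun k => rademacher R k x ^+ binary_digit n k))//.
rewrite big_mkcond/=; apply: eq_bigr => k _; case: ifPn => //.
by rewrite -leqNgt => /binary_digit_eq0 ->; rewrite expr0.
Qed.

Lemma binary_digitD (q L t k : nat) : (t < 2 ^ L)%N ->
  binary_digit (q * 2 ^ L + t) k = binary_digit (q * 2 ^ L) k (+) binary_digit t k.
Proof.
move=> tL; rewrite /binary_digit; have [kL|Lk] := ltnP k L.
  have -> : (2 ^ L = 2 ^ (L - k) * 2 ^ k)%N by rewrite -expnD subnK// ltnW.
  by rewrite mulnA divnMDl ?expn_gt0// mulnK ?expn_gt0// oddD.
have -> : (2 ^ k = 2 ^ L * 2 ^ (k - L))%N by rewrite -expnD subnKC.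
rewrite !divnMA divnMDl ?expn_gt0// mulnK ?expn_gt0//.
by rewrite (divn_small tL) div0n addn0 addbF.
Qed.

(** No carry occurs when [t < 2 ^ L] is added to a multiple of [2 ^ L]. *)
Lemma walshD (q L t : nat) x : (t < 2 ^ L)%N ->
  walsh (q * 2 ^ L + t) x = walsh (q * 2 ^ L) x * walsh t x.
Proof.
move=> tL; rewrite (@walshE (q * 2 ^ L) (q * 2 ^ L + t)) ?leq_addr//.
rewrite (@walshE t (q * 2 ^ L + t)) ?leq_addl// (@walshE _ (q * 2 ^ L + t))//.
rewrite -big_split/=; apply: eq_bigr => k _.
rewrite binary_digitD// /rademacher.
by case: (binary_digit _ _); case: (binary_digit _ _); case: (x k);
  rewrite /= ?expr1 ?expr0 ?mulr1 ?mul1r ?mulrNN ?mulr1.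
Qed.

Lemma walsh_norm (n : nat) x : `|walsh n x| = 1.
Proof.
rewrite /Defs.walsh normr_prod big1// => k _.
by rewrite normrX /rademacher normrX normrN1 !expr1n.
Qed.

Definition zero_interval (n : nat) : set walsh_group :=
  dyadic_interval n (fun=> false).

(** Below [2 ^ m.+1] only the digit of rank [m] of the index can matter, since the
    coordinates of [x] of rank below [m] vanish. *)
Lemma walsh_on_zero_interval (m i : nat) x :
  zero_interval m x -> (i < 2 ^ m.+1)%N ->
  walsh i x = rademacher R m x ^+ (2 ^ m <= i)%N.
Proof.
move=> xm im; rewrite (@walshE _ (i + m.+1)%N) ?leq_addr//.
have mlt : (m < i + m.+1)%N by lia.
rewrite (bigD1 (Ordinal mlt))//= [X in _ * X]big1 ?mulr1; last first.
  move=> k; rewrite -val_eqE/= => km.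
  have [ltkm|] := ltnP k m; first by rewrite /rademacher (xm k ltkm) expr0 expr1n.
  move=> mk; rewrite /binary_digit divn_small ?expr0//.
  rewrite (leq_trans im)// leq_exp2l//; lia.
congr (_ ^+ _); rewrite /binary_digit; have [h|h] := leqP (2 ^ m) i.
  rewrite (_ : i %/ 2 ^ m = 1)%N//; apply/eqP.
  rewrite eqn_leq divn_gt0 ?expn_gt0// h.
  by rewrite andbT -ltnS ltn_divLR ?expn_gt0// -expnS.
by rewrite divn_small.
Qed.

Definition dirichlet (k : nat) x : R := \sum_(i < k) walsh i x.

(** Within a block of length [2 ^ m.+1] the Walsh functions keep one sign on the
    first half and take the opposite one on the second: the partial sums go up to
    [2 ^ m] and back to zero, where the next block starts afresh. *)
Lemma dirichlet_block (m q t : nat) x : zero_interval m x -> x m ->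
  (t <= 2 ^ m.+1)%N ->
  dirichlet (q * 2 ^ m.+1 + t) x
  = walsh (q * 2 ^ m.+1) x * (minn t (2 ^ m.+1 - t))%:R.
Proof.
move=> xm xm1.
have step p t' : (t' < 2 ^ m.+1)%N ->
    dirichlet (p * 2 ^ m.+1 + t') x
      = walsh (p * 2 ^ m.+1) x * (minn t' (2 ^ m.+1 - t'))%:R ->
    dirichlet (p * 2 ^ m.+1 + t'.+1) x
      = walsh (p * 2 ^ m.+1) x * (minn t'.+1 (2 ^ m.+1 - t'.+1))%:R.
  move=> tm ih; rewrite addnS /dirichlet big_ord_recr/= -/(dirichlet _ x) ih.
  rewrite walshD// -mulrDr; congr (_ * _).
  rewrite (walsh_on_zero_interval xm)// /rademacher xm1 expr1.
  move: tm; rewrite expnS mul2n -addnn => tm.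
  have [h|h] := leqP (2 ^ m) t'.
    rewrite (_ : minn t' _ = 1 + minn t'.+1 (2 ^ m + 2 ^ m - t'.+1))%N; last by lia.
    by rewrite natrD expr1; ring.
  rewrite expr0 (_ : minn t'.+1 _ = minn t' (2 ^ m + 2 ^ m - t') + 1)%N.
    by rewrite natrD.
  by lia.
elim: q t => [|q ihq]; elim=> [|t iht] tm;
  try by apply: step => //; exact: iht (ltnW tm).
  by rewrite /dirichlet big_ord0 min0n mulr0.
by rewrite addn0 mulSn addnC ihq// subnn minn0 min0n !mulr0.
Qed.

Lemma normr_dirichlet (m k : nat) x : zero_interval m x -> x m ->
  `|dirichlet k x| = (tent m k)%:R.
Proof.
move=> xm xm1; rewrite {1}(divn_eq k (2 ^ m.+1)) dirichlet_block//.
  by rewrite normrM walsh_norm mul1r normr_nat.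
by rewrite ltnW// ltn_mod expn_gt0.
Qed.

End walsh_system.

(** * Integrals of tensor products *)

Section tensor.
Context d1 d2 (T1 : measurableType d1) (T2 : measurableType d2) (R : realType).
Context (P : probability T1 R) (Q : probability T2 R) (g : T1 -> R) (h : T2 -> R).
Context (ig : P.-integrable setT (EFin \o g)).
Context (ih : Q.-integrable setT (EFin \o h)).

Lemma integrable_tensor :
  (P \x Q)%E.-integrable setT (EFin \o (fun z => g z.1 * h z.2)).
Proof.
have mg : measurable_fun setT g by apply/measurable_EFinP; case/integrableP: ig.
have mh : measurable_fun setT h by apply/measurable_EFinP; case/integrableP: ih.
have mgh : measurable_fun setT (EFin \o (fun z : T1 * T2 => g z.1 * h z.2)).
  by apply/measurable_EFinP/measurable_funM; exact: measurableT_comp.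
apply/integrable12ltyP => //.
have [_ gfin] := integrableP _ _ _ ig; have [_ hfin] := integrableP _ _ _ ih.
under eq_integral => x _.
  under eq_integral => y _ do rewrite /= normrM EFinM.
  rewrite ge0_integralZl//; last first.
    by apply/measurable_EFinP; exact: measurableT_comp.
  over.
rewrite ge0_integralZr//=.
- apply: lte_mul_pinfty => //; first exact: integral_ge0.
  by rewrite ge0_fin_numE//; exact: integral_ge0.
- by apply/measurable_EFinP; exact: measurableT_comp.
- exact: integral_ge0.
Qed.

Lemma Rintegral_tensor :
  \int[(P \x Q)%E]_z (g z.1 * h z.2) = \int[P]_x g x * \int[Q]_y h y.
Proof.
rewrite /Rintegral -(integral12_prod_meas1 integrable_tensor) /fubini_F/=.
under eq_integral => x _.
  under eq_integral => y _ do rewrite EFinM.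
  rewrite integralZl//.
  over.
rewrite -[X in fine (\int[P]_x (_ * X))]fineK; last exact: integrable_fin_num.
rewrite integralZr// fineM//; exact: integrable_fin_num.
Qed.

End tensor.

(** * Measure and integrability on the Walsh group *)

Section dyadic_measure.
Context {R : realType}.
Local Notation mu := (walsh_measure R).
Implicit Types x : walsh_group.

Lemma measurable_coordinate k : measurable_fun setT (fun x => x k).
Proof.
move=> _ B _; rewrite setTI; apply: sub_sigma_algebra; by exists k, B.
Qed.

Lemma dyadic_intervalE n x :
  dyadic_interval n x = rectangle n (fun k => [set x k]).
Proof. by []. Qed.

Lemma measurable_dyadic_interval n x : measurable (dyadic_interval n x).
Proof.
by rewrite dyadic_intervalE; exact: (measurable_rectangle n (fun k => [set x k])).
Qed.

Lemma walsh_measure_dyadic_interval n x :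
  mu (dyadic_interval n x) = (2^-1 ^+ n)%:E.
Proof.
rewrite dyadic_intervalE walsh_measureP.
under eq_bigr => k _ do rewrite haarZ2_set1.
by rewrite prodEFin prodr_const card_ord.
Qed.

Lemma measurable_walsh n : measurable_fun setT (walsh R n).
Proof.
apply: measurable_prod => k _.
apply: measurable_funX; rewrite /rademacher.
have -> : (fun x : walsh_group => (-1) ^+ x k)
    = (fun b : bool => (-1) ^+ b : R) \o (fun x => x k) by [].
by apply: measurableT_comp => //; exact: measurable_coordinate.
Qed.

Lemma bounded_integrable d (T : measurableType d) (P : probability T R)
    (g : T -> R) (M : R) :
  measurable_fun setT g -> (forall t : T, `|g t| <= M) ->
  P.-integrable setT (EFin \o g).
Proof.
move=> mg gM; apply: measurable_bounded_integrable => //.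
  by rewrite (le_lt_trans (probability_le1 _ _)) ?ltry.
exists M; split; rewrite ?num_real// => y My x _.
exact: le_trans (gM x) (ltW My).
Qed.

End dyadic_measure.

(** * Atoms of Hardy norm one *)

Section atom.
Context {R : realType}.
Local Notation mu := (walsh_measure R).
Local Notation mu2 := (walsh_measure2 R).
Implicit Types x : walsh_group.

Lemma integrable_zero_interval n :
  mu.-integrable setT (EFin \o \1_(zero_interval n)).
Proof. by apply: integrable_indic; exact: measurable_dyadic_interval. Qed.

Lemma Rintegral_zero_interval n :
  \int[mu]_x \1_(zero_interval n) x = 2^-1 ^+ n :> R.
Proof.
rewrite /Rintegral integral_indic ?setIT//; last exact: measurable_dyadic_interval.
exact: (congr1 fine (walsh_measure_dyadic_interval n _)).
Qed.

(** The difference of the Dirichlet kernels of orders [2 ^ N.+1] and [2 ^ N]. *)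
Definition atom (N : nat) x : R :=
  2 ^+ N.+1 * \1_(zero_interval N.+1) x - 2 ^+ N * \1_(zero_interval N) x.

Lemma zero_intervalS N x :
  zero_interval N.+1 x <-> zero_interval N x /\ x N = false.
Proof.
split=> [h|[h xN] k]; first by split=> [k kN|]; apply: h => //; exact: ltnW.
by rewrite ltnS leq_eqVlt => /predU1P[->//|]; exact: h.
Qed.

Lemma atomE N x :
  atom N x = 2 ^+ N * rademacher R N x * \1_(zero_interval N) x.
Proof.
rewrite /atom !indicE /rademacher.
have [|xN] := boolP (x \in zero_interval N); last first.
  rewrite (_ : _ \in zero_interval N.+1 = false) ?mulr0 ?subr0//.
  by apply: contraNF xN; rewrite !inE => /zero_intervalS[].
rewrite inE => xN; case xN1 : (x N).
  rewrite memNset => [|/zero_intervalS[_]]; last by rewrite xN1.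
  by rewrite /= expr1; ring.
rewrite mem_set; last by apply/zero_intervalS.
by rewrite /= exprS expr0; ring.
Qed.

Lemma normr_atom N x : `|atom N x| = 2 ^+ N * \1_(zero_interval N) x.
Proof.
rewrite atomE !normrM normrX normr_nat /rademacher normrX normrN1 expr1n mulr1.
by rewrite indicE normr_nat.
Qed.

Lemma integrable_scaled_zero_interval (c : R) n :
  mu.-integrable setT (EFin \o (fun x => c * \1_(zero_interval n) x)).
Proof. exact: (integrableZl measurableT c (integrable_zero_interval n)). Qed.

Lemma integrable_atom N : mu.-integrable setT (EFin \o atom N).
Proof.
exact: (integrableB measurableT
  (integrable_scaled_zero_interval (2 ^+ N.+1) N.+1)
  (integrable_scaled_zero_interval (2 ^+ N) N)).
Qed.

Lemma Rintegral_scaled_zero_interval n :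
  \int[mu]_x (2 ^+ n * \1_(zero_interval n) x) = 1 :> R.
Proof.
rewrite RintegralZl//; last exact: integrable_zero_interval.
by rewrite Rintegral_zero_interval exprVn divff// expf_neq0.
Qed.

Lemma Rintegral_atom N : \int[mu]_x atom N x = 0.
Proof.
rewrite RintegralB//; [|exact: integrable_scaled_zero_interval..].
by rewrite !Rintegral_scaled_zero_interval subrr.
Qed.

(** On the support of the atom the Walsh function is [1] for [i < 2 ^ N] and the
    Rademacher factor of the atom for larger [i]. *)
Lemma Rintegral_atom_walsh N i : (i < 2 ^ N.+1)%N ->
  \int[mu]_x (atom N x * walsh R i x) = (2 ^ N <= i)%N%:R.
Proof.
move=> iN; have [Ni|iN'] := leqP (2 ^ N) i.
  rewrite -(Rintegral_scaled_zero_interval N); apply: eq_Rintegral => x _.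
  rewrite atomE indicE; have [|_] := boolP (x \in _); last by rewrite !mulr0 mul0r.
  rewrite inE => xN; rewrite (walsh_on_zero_interval xN)// Ni.
  by rewrite /rademacher; case: (x N); rewrite /= !expr1 ?expr0; ring.
transitivity (\int[mu]_x atom N x); last exact: Rintegral_atom.
apply: eq_Rintegral => x _; rewrite atomE indicE.
have [|_] := boolP (x \in _); last by rewrite !mulr0 mul0r.
rewrite inE => xN; rewrite (walsh_on_zero_interval xN)//.
by rewrite leqNgt iN' expr0 mulr1.
Qed.

Definition square_atom N (z : walsh_group * walsh_group) : R :=
  atom N z.1 * atom N z.2.

Lemma integrable_square_atom N : mu2.-integrable setT (EFin \o square_atom N).
Proof. by apply: integrable_tensor; exact: integrable_atom. Qed.

Lemma integrable_mul_walsh (g : walsh_group -> R) i :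
  mu.-integrable setT (EFin \o g) ->
  mu.-integrable setT (EFin \o (fun x => g x * walsh R i x)).
Proof.
move=> ig; apply: (@integrableMl _ _ _ mu setT measurableT
  (EFin \o g) (walsh R i)) => //.
  exact: measurable_walsh.
exists 1; split; rewrite ?num_real// => M M1 x _ /=.
by rewrite walsh_norm ltW.
Qed.

Lemma fourier_coef_square_atom N i j : (i < 2 ^ N.+1)%N -> (j < 2 ^ N.+1)%N ->
  fourier_coef (square_atom N) i j = (2 ^ N <= i)%N%:R * (2 ^ N <= j)%N%:R.
Proof.
move=> iN jN; rewrite -!Rintegral_atom_walsh//.
rewrite -Rintegral_tensor; [|apply: integrable_mul_walsh; exact: integrable_atom..].
by apply: eq_Rintegral => z _; rewrite /square_atom; ring.
Qed.

(** A dyadic interval of rank [n <= N] either contains the support of the atom, whose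
    integral is zero, or misses it. *)
Lemma Rintegral_atom_dyadic_interval N n x : (n <= N)%N ->
  \int[mu]_y (atom N \_ (dyadic_interval n x)) y = 0.
Proof.
move=> nN; have [x0|x0] := pselect (zero_interval n x).
  rewrite -(Rintegral_atom N); apply: eq_Rintegral => y _.
  rewrite patchE; case: ifPn => // /negP yx; rewrite atomE indicE memNset ?mulr0//.
  move=> yN; apply: yx; rewrite inE => k kn; rewrite (x0 k kn).
  by apply: yN; exact: leq_trans kn nN.
rewrite (@eq_Rintegral _ _ _ _ _ (cst 0)); last first.
  move=> y _; rewrite patchE; case: ifPn => //; rewrite inE => yx.
  rewrite atomE indicE memNset ?mulr0// => yN; apply: x0 => k kn.
  by rewrite -(yx k kn) yN//; exact: leq_trans kn nN.
by rewrite Rintegral_cst// mul0r.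
Qed.

Lemma measurable_dyadic_square n z : measurable (@dyadic_square n z).
Proof. by apply: measurableX; exact: measurable_dyadic_interval. Qed.

Lemma walsh_measure2_dyadic_square n z :
  mu2 (@dyadic_square n z) = (2^-1 ^+ n * 2^-1 ^+ n)%:E.
Proof.
transitivity (mu (dyadic_interval n z.1) * mu (dyadic_interval n z.2))%E.
  by apply: product_measure1E; exact: measurable_dyadic_interval.
by rewrite !walsh_measure_dyadic_interval.
Qed.

Lemma Rintegral_square_atom_coarse N n z : (n <= N)%N ->
  \int[mu2]_(w in dyadic_square n z) square_atom N w = 0.
Proof.
move=> nN; rewrite Rintegral_mkcond.
have i1 x : mu.-integrable setT (EFin \o (atom N \_ (dyadic_interval n x))).
  rewrite -restrict_EFin -integrable_mkcond; last exact: measurable_dyadic_interval.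
  by apply: integrableS (integrable_atom N) => //; exact: measurable_dyadic_interval.
transitivity (\int[mu2]_w ((atom N \_ (dyadic_interval n z.1)) w.1 *
                           (atom N \_ (dyadic_interval n z.2)) w.2)); last first.
  by rewrite Rintegral_tensor// Rintegral_atom_dyadic_interval// mul0r.
apply: eq_Rintegral => w _; rewrite !patchE /square_atom /dyadic_square in_setX.
by case: (_ \in _); case: (_ \in _); rewrite /= ?mul0r ?mulr0.
Qed.

Lemma atom_dyadic_interval N n x y : (N < n)%N ->
  dyadic_interval n x y -> atom N y = atom N x.
Proof.
move=> Nn yx; rewrite !atomE /rademacher (yx _ Nn) !indicE; congr (_ * _%:R).
apply: congr1; apply/idP/idP; rewrite !inE => h k kN.
- by rewrite -yx ?h//; exact: ltn_trans kN Nn.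
- by rewrite yx ?h//; exact: ltn_trans kN Nn.
Qed.

(** Squares of rank at most [N] have mean zero, and on smaller ones the function is
    constant. *)
Lemma dyadic_maximal_square_atom N z :
  dyadic_maximal (square_atom N) z = `|square_atom N z|%:E.
Proof.
have fine_level n : (N < n)%N ->
    (fine (mu2 (dyadic_square n z)))^-1 *
      `|\int[mu2]_(w in dyadic_square n z) square_atom N w|
    = `|square_atom N z|.
  move=> Nn; rewrite (@eq_Rintegral _ _ _ _ _ (cst (square_atom N z))); last first.
    move=> w; rewrite inE => -[w1 w2]; rewrite /square_atom.
    by rewrite (atom_dyadic_interval Nn w1) (atom_dyadic_interval Nn w2).
  rewrite Rintegral_cst; last exact: measurable_dyadic_square.
  rewrite normrM; set q : R := 2^-1 ^+ n * 2^-1 ^+ n.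
  have sqE : fine (mu2 (dyadic_square n z)) = q.
    exact: (congr1 fine (walsh_measure2_dyadic_square n z)).
  have q0 : 0 < q by rewrite mulr_gt0// exprn_gt0// invr_gt0.
  transitivity (q^-1 * (`|square_atom N z| * `|q|)).
    rewrite /cst sqE; congr (_ * (_ * `|_|)); exact: sqE.
  by rewrite (gtr0_norm q0) mulrC mulfK// gt_eqF.
apply/eqP; rewrite eq_le; apply/andP; split; last first.
  by apply: ereal_sup_ubound; exists N.+1; rewrite // fine_level.
apply: ge_ereal_sup => _ [n _ <-]; rewrite lee_fin.
have [nN|Nn] := leqP n N; last by rewrite fine_level.
by rewrite Rintegral_square_atom_coarse// normr0 mulr0.
Qed.

Lemma hardy_norm_square_atom N : hardy_norm (square_atom N) = 1%E.
Proof.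
rewrite /hardy_norm Lnorm1.
under eq_integral => z _.
  rewrite dyadic_maximal_square_atom/= normr_id /square_atom normrM !normr_atom.
  over.
have := Rintegral_tensor (integrable_scaled_zero_interval (2 ^+ N) N)
  (integrable_scaled_zero_interval (2 ^+ N) N).
rewrite Rintegral_scaled_zero_interval mulr1 /Rintegral => h.
rewrite -[LHS]fineK; first by congr EFin.
have iF := integrable_scaled_zero_interval (2 ^+ N) N.
exact: (integrable_fin_num measurableT (integrable_tensor iF iF)).
Qed.

End atom.

(** * Partial sums of the atoms *)

Section lower_bound.
Context {R : realType}.
Local Notation mu := (walsh_measure R).
Implicit Types x : walsh_group.

(** The partial sum of order [k] of the Walsh series of [atom N], when
    [2 ^ N <= k <= 2 ^ N.+1]. *)
Definition dirichlet_tail (N k : nat) x : R :=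
  dirichlet k x - dirichlet (2 ^ N) x.

Lemma dirichlet_tailE N k x : (2 ^ N <= k)%N ->
  dirichlet_tail N k x = \sum_(i < k) (2 ^ N <= i)%N%:R * walsh R i x.
Proof.
move=> Nk; rewrite /dirichlet_tail /dirichlet.
rewrite -!(big_mkord xpredT (fun i => walsh R i x)).
rewrite -(big_mkord xpredT (fun i => (2 ^ N <= i)%N%:R * walsh R i x)).
rewrite !(@big_cat_nat _ _ _ (2 ^ N) 0 k)//= addrAC subrr add0r.
rewrite [X in _ = X + _]big_nat_cond [X in _ = X + _]big1 ?add0r; last first.
  by move=> i /andP[/andP[_ iN] _]; rewrite leqNgt iN mul0r.
by apply: eq_big_nat => i /andP[-> _]; rewrite mul1r.
Qed.

Lemma partial_sum_square_atom N k z : (2 ^ N <= k)%N -> (k <= 2 ^ N.+1)%N ->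
  partial_sum k k (square_atom N) z
  = dirichlet_tail N k z.1 * dirichlet_tail N k z.2.
Proof.
move=> Nk kN; rewrite !dirichlet_tailE// mulr_suml /partial_sum.
apply: eq_bigr => i _; rewrite mulr_sumr; apply: eq_bigr => j _.
rewrite fourier_coef_square_atom; first by ring.
- exact: leq_trans (ltn_ord i) kN.
- exact: leq_trans (ltn_ord j) kN.
Qed.

Lemma integrable_dirichlet k : mu.-integrable setT (EFin \o dirichlet k).
Proof.
apply: (@bounded_integrable _ _ _ _ _ k%:R) => [|x].
  by apply: measurable_sum => i; exact: measurable_walsh.
rewrite (le_trans (ler_norm_sum _ _ _))// (eq_bigr (fun=> 1)).
  by rewrite sumr_const card_ord.
by move=> i _; exact: walsh_norm.
Qed.

Lemma integrable_normr_dirichlet_tail N k :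
  mu.-integrable setT (EFin \o (fun x => `|dirichlet_tail N k x|)).
Proof.
exact: (integrable_norm (integrableB measurableT (integrable_dirichlet k)
  (integrable_dirichlet (2 ^ N)))).
Qed.

Lemma norm1_partial_sum_square_atom N k : (2 ^ N <= k)%N -> (k <= 2 ^ N.+1)%N ->
  norm1 (partial_sum k k (square_atom N))
  = ((\int[mu]_x `|dirichlet_tail N k x|) ^+ 2)%:E.
Proof.
move=> Nk kN; have iF := integrable_normr_dirichlet_tail N k.
rewrite /norm1 Lnorm1.
under eq_integral => z _ do rewrite /= partial_sum_square_atom// normrM.
have := Rintegral_tensor iF iF; rewrite expr2 => <-.
rewrite -[LHS]fineK//.
exact: (integrable_fin_num measurableT (integrable_tensor iF iF)).
Qed.

(** A lower bound for the Lebesgue constant of order [k]: the factor [2^-1 ^+ m.+1] is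
    the measure of the annulus of rank [m], on which the Dirichlet kernel has absolute
    value [tent m k]. *)
Definition tent_average (N k : nat) : R :=
  \sum_(m < N) (tent m k)%:R * 2^-1 ^+ m.+1.

(** [2 ^ N] is a multiple of [2 ^ m.+1], so the subtracted kernel vanishes here. *)
Lemma normr_dirichlet_tail N k m x : (m < N)%N -> zero_interval m x -> x m ->
  `|dirichlet_tail N k x| = (tent m k)%:R.
Proof.
move=> mN xm xm1; suff D0 : dirichlet (2 ^ N) x = 0 :> R.
  by rewrite /dirichlet_tail D0 subr0; exact: normr_dirichlet.
apply/normr0_eq0; rewrite (normr_dirichlet _ xm)//.
by rewrite /tent (eqP (dvdn_exp2l 2 mN)) min0n.
Qed.

(** The annuli of rank below [N] are disjoint; their indicators telescope. *)
Lemma le_tent_average N k :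
  tent_average N k <= \int[mu]_x `|dirichlet_tail N k x|.
Proof.
pose annulus m x : R := \1_(zero_interval m) x - \1_(zero_interval m.+1) x.
have integrable_annulus m : mu.-integrable setT (EFin \o annulus m).
  exact: (integrableB measurableT (integrable_zero_interval m)
    (integrable_zero_interval m.+1)).
have Rintegral_annulus m : \int[mu]_x annulus m x = 2^-1 ^+ m.+1.
  rewrite RintegralB//; [|exact: integrable_zero_interval..].
  by rewrite !Rintegral_zero_interval exprS; lra.
have annulus_ge0 m x : 0 <= annulus m x.
  rewrite /annulus !indicE subr_ge0 ler_nat.
  case: (boolP (x \in zero_interval m.+1)) => //; rewrite inE.
  move=> /zero_intervalS[xm _].
  by rewrite mem_set.
have annulusE m x : (m < N)%N ->
    (tent m k)%:R * annulus m x = `|dirichlet_tail N k x| * annulus m x.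
  move=> mN; rewrite /annulus !indicE.
  have [|xm] := boolP (x \in zero_interval m); last first.
    rewrite (_ : x \in zero_interval m.+1 = false) ?subrr ?mulr0//.
    by apply: contraNF xm; rewrite !inE => /zero_intervalS[].
  rewrite inE => xm; case xm1 : (x m).
    by rewrite (normr_dirichlet_tail _ mN xm).
  by rewrite mem_set ?subrr ?mulr0//; exact/zero_intervalS.
pose U n x := \sum_(m < n) (tent m k)%:R * annulus m x.
have iU n : mu.-integrable setT (EFin \o U n) /\
    \int[mu]_x U n x = \sum_(m < n) (tent m k)%:R * 2^-1 ^+ m.+1.
  elim: n => [|n [ih1 ih2]].
    split; first by rewrite (_ : EFin \o _ = cst 0%E) ?integrable0//;
      apply/funext => x; rewrite /U /= big_ord0.
    rewrite big_ord0 (@eq_Rintegral _ _ _ _ _ (cst 0)) ?Rintegral_cst ?mul0r//.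
    by move=> x _; rewrite /U big_ord0.
  have US : U n.+1 = (fun x => U n x + (tent n k)%:R * annulus n x).
    by apply/funext => x; rewrite /U big_ord_recr.
  have ilast := integrableZl measurableT (tent n k)%:R (integrable_annulus n).
  split; first by rewrite US; exact: (integrableD measurableT ih1 ilast).
  by rewrite US RintegralD// ih2 RintegralZl// Rintegral_annulus big_ord_recr.
have [iUN IUN] := iU N; rewrite /tent_average -IUN.
apply: le_Rintegral => //; first exact: integrable_normr_dirichlet_tail.
move=> x _; rewrite /U.
under eq_bigr => m _ do rewrite annulusE//.
rewrite -mulr_sumr ler_piMr// -(big_mkord xpredT (fun m => annulus m x)).
rewrite (eq_bigr (fun m =>
    - (\1_(zero_interval m.+1) x - \1_(zero_interval m) x))); last first.
  by move=> m _; rewrite opprB.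
by rewrite sumrN telescope_sumr// opprB !indicE.
Qed.

Lemma sum_tent_average N :
  \sum_(2 ^ N <= k < 2 ^ N.+1) tent_average N k = N%:R / 4 * 2 ^+ N.
Proof.
rewrite exchange_big/= (eq_bigr (fun=> 2 ^+ N / 4)); last first.
  move=> m _; rewrite -mulr_suml -natr_sum sum_tent_dyadic// natrX.
  have := ltn_ord m; case: N m => [[]//|N] m _.
  rewrite addSn/= exprD !exprS exprVn -!mulrA.
  have : (2 : R) ^+ m != 0 by rewrite expf_neq0.
  by move=> h; field.
by rewrite sumr_const card_ord -mulr_natr; field.
Qed.

Lemma sum_sqr_tent_average N :
  (N%:R ^+ 2 / 16) * 2 ^+ N <= \sum_(2 ^ N <= k < 2 ^ N.+1) tent_average N k ^+ 2.
Proof.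
(* The square is bounded below by its tangent at the mean value c of the block. *)
pose c : R := N%:R / 4.
have h : \sum_(2 ^ N <= k < 2 ^ N.+1) (2 * c * tent_average N k - c ^+ 2)
    = (N%:R ^+ 2 / 16) * 2 ^+ N.
  rewrite big_split/= -mulr_sumr sum_tent_average.
  rewrite sumr_const_nat expnS mul2n -addnn addnK -[X in _ + X]mulr_natr natrX /c.
  by field.
rewrite -h; apply: ler_sum => k _.
have := sqr_ge0 (tent_average N k - c); nra.
Qed.

End lower_bound.

(** * Divergence of the weighted series *)

Lemma ln_succ_le_dyadic (R : realType) (k N : nat) : (k < 2 ^ N.+1)%N ->
  ln (k.+1%:R : R) <= N.+1%:R.
Proof.
move=> kN; have : ln (k.+1%:R : R) <= ln (2 ^+ N.+1).
  by rewrite ler_ln ?posrE ?exprn_gt0// -natrX ler_nat.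
move=> /le_trans; apply; rewrite lnXn// -[leLHS]mulr_natl ler_piMr//.
by have := @le_ln1Dx R 1; rewrite -[1 + 1]/2 => h; apply: h; lra.
Qed.

(** Only the block [2 ^ N <= n < 2 ^ N.+1] is kept. The constant is
    [128 = 16 * 2 * 4]: [16] from [sum_sqr_tent_average], [2] from
    [n <= 2 * 2 ^ N] and [4] from [N.+1 ^ 2 <= 4 * N ^ 2]. *)
Lemma norm1_partial_sum_series_ge (R : realType) (Phi : nat -> R) (N : nat) :
  (forall n : nat, 1 <= Phi n) ->
  (forall m n : nat, (m <= n)%N -> Phi m <= Phi n) -> (0 < N)%N ->
  ((Phi (2 ^ N)%N / 128)%:E <=
    \sum_(1 <= n <oo) norm1 (partial_sum n n (@square_atom R N)) *
      (Phi n / (n%:R * ln n.+1%:R ^+ 2))%:E)%E.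
Proof.
move=> Phi1 Phi_nd N0.
have Phi0 n : 0 < Phi n by rewrite (lt_le_trans _ (Phi1 n)).
pose w n : R := Phi n / (n%:R * ln n.+1%:R ^+ 2).
have w0 n : 0 <= w n.
  by apply: divr_ge0; [exact: ltW|rewrite mulr_ge0// sqr_ge0].
have term_ge0 n : (0 <= norm1 (partial_sum n n (@square_atom R N)) * (w n)%:E)%E.
  by apply: mule_ge0; [exact: Lnorm_ge0|rewrite lee_fin].
apply: le_trans (nneseries_lim_ge (2 ^ N.+1) (fun n _ _ => term_ge0 n)).
rewrite (@big_cat_nat _ _ _ (2 ^ N))/= ?expn_gt0 ?leq_exp2l//.
apply: (@le_trans _ _ (\sum_(2 ^ N <= n < 2 ^ N.+1)
    norm1 (partial_sum n n (@square_atom R N)) * (w n)%:E)%E); last first.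
  by rewrite leeDr// sume_ge0.
pose v : R := Phi (2 ^ N)%N / (2 ^+ N.+1 * N.+1%:R ^+ 2).
have v0 : 0 <= v.
  by apply: divr_ge0; [exact: ltW|rewrite mulr_ge0// exprn_ge0].
have vw k : (2 ^ N <= k)%N -> (k < 2 ^ N.+1)%N -> v <= w k.
  move=> Nk kN; have k0 : (0 < k)%N by rewrite (leq_trans _ Nk)// expn_gt0.
  have lnk : 0 < ln (k.+1%:R : R) by rewrite ln_gt0// ltr1n.
  rewrite /v /w ler_pM ?(ltW (Phi0 _))// ?Phi_nd//.
  rewrite lef_pV2 ?posrE ?mulr_gt0 ?exprn_gt0 ?ltr0n//.
  apply: ler_pM => //; first exact: sqr_ge0.
    by rewrite -natrX ler_nat ltnW.
  by rewrite lerXn2r ?nnegrE// ?(ltW lnk)// ln_succ_le_dyadic.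
apply: (@le_trans _ _ (\sum_(2 ^ N <= n < 2 ^ N.+1)
    (tent_average N n ^+ 2 * v)%:E)%E); last first.
  rewrite !big_nat; apply: lee_sum => k /andP[Nk kN].
  rewrite norm1_partial_sum_square_atom ?(ltnW kN)// -EFinM lee_fin.
  have t0 : 0 <= tent_average N k :> R.
    by apply: sumr_ge0 => m _; rewrite mulr_ge0// exprn_ge0// invr_ge0.
  rewrite ler_pM// ?sqr_ge0 ?vw//.
  by rewrite lerXn2r ?nnegrE ?le_tent_average// (le_trans t0 (le_tent_average N k)).
rewrite sumEFin lee_fin -mulr_suml.
apply: le_trans (ler_wpM2r v0 (sum_sqr_tent_average N)).
have -> : N%:R ^+ 2 / 16 * 2 ^+ N * v
    = Phi (2 ^ N)%N / 128 * (4 * (N%:R ^+ 2 / N.+1%:R ^+ 2)).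
  have h1 : (2 : R) ^+ N != 0 by rewrite expf_neq0.
  have h2 : (N.+1%:R : R) != 0 by rewrite pnatr_eq0.
  rewrite /v (exprS 2 N); move: h1 h2.
  move: (2 ^+ N) N.+1%:R N%:R (Phi _) => p s t F h1 h2; by field; rewrite h1 h2.
rewrite ler_peMr ?divr_ge0 ?(ltW (Phi0 _))// mulrA ler_pdivlMr ?exprn_gt0// mul1r.
rewrite (_ : 4 * N%:R ^+ 2 = (2 * N)%:R ^+ 2); last by rewrite natrM; ring.
by rewrite lerXn2r ?nnegrE// ler_nat; lia.
Qed.

Theorem theorem1 (R : realType) (Phi : nat -> R)
    (Phi_ge1 : forall n : nat, 1 <= Phi n)
    (Phi_nondecreasing : forall m n : nat, (m <= n)%N -> Phi m <= Phi n)
    (Phi_unbounded : Phi n @[n --> \oo] --> +oo) :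
  ereal_sup
    [set (\sum_(1 <= n <oo)
            norm1 (partial_sum n n f) *
              (Phi n / (n%:R * ln n.+1%:R ^+ 2))%:E)%E
    | f in [set f | hardy_space R f /\ (hardy_norm f <= 1)%E]] = +oo%E.
Proof.
apply/eq_infty => A.
have [N _ PhiN] := (cvgryPge _).1 Phi_unbounded (128 * A).
have PhiA : A <= Phi (2 ^ N.+1)%N / 128.
  rewrite ler_pdivlMr// mulrC; apply: PhiN => /=.
  by rewrite ltnW// (ltn_trans (ltnSn N))// ltn_expl.
apply: le_trans (ereal_sup_ubound _); last first.
  exists (square_atom N.+1) => //=; split; last by rewrite hardy_norm_square_atom.
  by split; [exact: integrable_square_atom|rewrite hardy_norm_square_atom ltry].
apply: le_trans (norm1_partial_sum_series_ge Phi_ge1 Phi_nondecreasing (ltn0Sn N)).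
by rewrite lee_fin.
Qed.
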